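(* Let $\mathcal{P}, \mathcal{Q} \subseteq \mathbb{R}^n$ be polytopes, each with at least two vertices, with pyramidal widths $\delta_{\mathcal{P}}$ and $\delta_{\mathcal{Q}}$. Then the pyramidal width of the Cartesian product $\mathcal{P}\times\mathcal{Q}\subseteq\mathbb{R}^n\times\mathbb{R}^n$ is $$\delta_{\mathcal{P}\times\mathcal{Q}} = \sqrt{\frac{\delta_{\mathcal{P}}^2\,\delta_{\mathcal{Q}}^2}{\delta_{\mathcal{P}}^2+\delta_{\mathcal{Q}}^2}}.$$
   Context: A polytope is the convex hull of a finite set of points. For a polytope $\mathcal{P}$, $\mathcal{V}_{\mathcal{P}}$ is its set of vertices, and a face of $\mathcal{P}$ is proper if it is neither $\emptyset$ nor $\mathcal{P}$ itself; $\mathsf{faces}^*(\mathcal{P})$ is the set of proper faces. $\|\cdot\|$ is the Euclidean norm, and $\mathsf{dist}(A,B)$ is the minimum of $\|x-y\|$ over $x\in A$, $y\in B$. For a polytope $\mathcal{P}$ with at least two vertices, the pyramidal width is $$\delta_{\mathcal{P}} := \min_{f\in\mathsf{faces}^*(\mathcal{P})} \mathsf{dist}\big(f,\ \mathrm{conv}(\mathcal{V}_{\mathcal{P}}\setminus f)\big).$$ *)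

(* Defs.v *)
From HB Require Import structures.
From mathcomp Require Import all_boot all_order all_algebra.
From mathcomp Require Import all_classical all_reals all_analysis.

Set Implicit Arguments.
Unset Strict Implicit.
Unset Printing Implicit Defensive.

Import Order.TTheory GRing.Theory Num.Theory.
Local Open Scope classical_set_scope.
Local Open Scope ring_scope.

Definition dotr (R : realType) (n : nat) (u v : 'rV[R]_n) : R :=
  \sum_(i < n) u 0 i * v 0 i.

(* The library norm `|u| on 'rV[R]_n is the sup norm, hence this definition. *)
Definition enorm (R : realType) (n : nat) (u : 'rV[R]_n) : R :=
  Num.sqrt (\sum_(i < n) u 0 i ^+ 2).

Definition conv_hull (R : realType) (n : nat) (A : set 'rV[R]_n) :
  set 'rV[R]_n := smallest (@convex_set R 'rV[R]_n) A.

Definition polytope (R : realType) (n : nat) (P : set 'rV[R]_n) : Prop :=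
  exists2 S : set 'rV[R]_n, finite_set S & P = conv_hull S.

(* A face is the part of P on which a valid inequality c . x <= b is tight;
   c = 0 gives the faces P (b = 0) and set0 (b > 0). *)
Definition face (R : realType) (n : nat) (P F : set 'rV[R]_n) : Prop :=
  exists (c : 'rV[R]_n) (b : R),
    (forall x, P x -> dotr c x <= b) /\ F = P `&` [set x | dotr c x = b].

Definition proper_faces (R : realType) (n : nat) (P : set 'rV[R]_n) :
  set (set 'rV[R]_n) := [set F | [/\ face P F, F <> set0 & F <> P]].

Definition vertices (R : realType) (n : nat) (P : set 'rV[R]_n) :
  set 'rV[R]_n := [set v | face P [set v]].

(* The least element of S; the value is 0 when S has no least element, which
   never happens for the sets arising in the pyramidal width of a polytope with
   at least two vertices. *)
Definition minimum (R : realType) (S : set R) : R := xget 0 (S `&` lbound S).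

Definition edist (R : realType) (n : nat) (A B : set 'rV[R]_n) : R :=
  minimum [set enorm (x - y) | x in A & y in B].

Definition pyramidal_width (R : realType) (n : nat) (P : set 'rV[R]_n) : R :=
  minimum [set edist F (conv_hull (vertices P `\` F)) | F in proper_faces P].

(* R^m x R^n is identified with R^(m + n) by concatenating coordinates, so the
   Euclidean norm satisfies |(x, y)|^2 = |x|^2 + |y|^2. *)
Definition cart_prod (R : realType) (m n : nat)
    (P : set 'rV[R]_m) (Q : set 'rV[R]_n) : set 'rV[R]_(m + n) :=
  [set row_mx x y | x in P & y in Q].

(* Main.v *)
Require Import Defs.
From HB Require Import structures.
From mathcomp Require Import all_boot all_order all_algebra.
From mathcomp Require Import all_classical all_reals all_analysis.
From mathcomp Require Import ring lra.

Set Implicit Arguments.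
Unset Strict Implicit.
Unset Printing Implicit Defensive.

Import Order.TTheory GRing.Theory Num.Theory.
Import numFieldNormedType.Exports.
Local Open Scope classical_set_scope.
Local Open Scope ring_scope.

(** Write [p] and [q] for the pyramidal widths of [P] and [Q].

    The nonempty faces of [P x Q] are the products [F x G] of nonempty faces
    ([face_cart], [face_cart_inv]), and its vertices are the pairs of vertices
    ([vertices_cart]). Let [A] be the hull of the vertices of [P] outside [F]
    and [B] the hull of the vertices of [Q] outside [G]. The hull of the
    vertices of [P x Q] outside [F x G] consists of the points
    [(s a + t x, s y + t b)] with [s + t = 1], [x] in [P], [y] in [Q], [a] in [A]
    and [b] in [B]. When [x, a] and [y, b] are pairs that realize [p] and [q],
    this point is at squared distance [(s p)^2 + (t q)^2] from [(x, y)], and the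
    minimum of that over [s + t = 1] is [p^2 q^2 / (p^2 + q^2)].

    The lower bound needs that the distance from [F] to [s A + t P] is at least
    [s p] for every nonempty face [F] of [P] ([dilate_dist]). This is not
    immediate: for [x] and [x'] in [F], the difference [x - t x'] need not lie in
    [s F]. It only lies in [s] times the affine hull of [F], which can be closer
    to [A] than [F] is. When it is not in [s F], cancelling [x] against [x'] along
    the line through both moves [x] to a proper face of [F] ([ray_exit]), and a
    descent through the faces concludes. So it is essential that the width is a
    minimum over all faces.

    The supporting facts about polytopes, that vertices generate them
    ([hull_vertices]) and that rays leave them through proper faces, come from
    nearest points in compact hulls. That a face of a face is a face
    ([face_trans]) comes from perturbing the outer inequality by the inner one. *)

(** * The inner product *)

Section InnerProduct.
Variables (R : realType) (n : nat).
Implicit Types (u v w : 'rV[R]_n) (a : R).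

Lemma dotrC u v : dotr u v = dotr v u.
Proof. by apply: eq_bigr => i _; rewrite mulrC. Qed.

Lemma dotrDr u v w : dotr u (v + w) = dotr u v + dotr u w.
Proof. by rewrite -big_split; apply: eq_bigr => i _; rewrite mxE mulrDr. Qed.

Lemma dotrZr a u v : dotr u (a *: v) = a * dotr u v.
Proof. by rewrite mulr_sumr; apply: eq_bigr => i _; rewrite mxE mulrCA. Qed.

Lemma dotrNr u v : dotr u (- v) = - dotr u v.
Proof. by rewrite -scaleN1r dotrZr mulN1r. Qed.

Lemma dotr0l v : dotr 0 v = 0.
Proof. by rewrite /dotr big1// => i _; rewrite mxE mul0r. Qed.

Lemma dotrDl u v w : dotr (u + v) w = dotr u w + dotr v w.
Proof. by rewrite dotrC dotrDr !(dotrC w). Qed.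

Lemma dotrZl a u v : dotr (a *: u) v = a * dotr u v.
Proof. by rewrite dotrC dotrZr dotrC. Qed.

Lemma dotrNl u v : dotr (- u) v = - dotr u v.
Proof. by rewrite dotrC dotrNr dotrC. Qed.

Definition dotrE := (dotrDr, dotrDl, dotrNr, dotrNl, dotrZr, dotrZl).

(** The squared Euclidean norm, used instead of [enorm] to keep inequalities
    polynomial. *)
Definition sqn u := dotr u u.

Lemma sqn_ge0 u : 0 <= sqn u.
Proof. by apply: sumr_ge0 => i _; rewrite -expr2 sqr_ge0. Qed.

Lemma sqn_eq0 u : sqn u = 0 -> u = 0.
Proof.
move=> /eqP; rewrite psumr_eq0 => [/allP u0|i _]; last by rewrite -expr2 sqr_ge0.
apply/rowP => i; rewrite mxE; apply/eqP; rewrite -sqrf_eq0 expr2.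
by apply: u0; rewrite mem_index_enum.
Qed.

Lemma sqn_gt0 u : u != 0 -> 0 < sqn u.
Proof.
move=> u0; rewrite lt_neqAle sqn_ge0 andbT eq_sym.
by apply: contra u0 => /eqP/sqn_eq0 ->.
Qed.

Lemma sqnZ a u : sqn (a *: u) = a ^+ 2 * sqn u.
Proof. by rewrite /sqn !dotrE expr2 mulrA. Qed.

Lemma sqnD_le u v : sqn (u + v) <= 2 * sqn u + 2 * sqn v.
Proof.
have := sqn_ge0 (u - v); rewrite /sqn !dotrE (dotrC v u); lra.
Qed.

Lemma enormE u : enorm u = Num.sqrt (sqn u).
Proof. by congr Num.sqrt; apply: eq_bigr => i _; rewrite expr2. Qed.

Lemma enorm_ge0 u : 0 <= enorm u.
Proof. exact: sqrtr_ge0. Qed.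

Lemma sqr_enorm u : enorm u ^+ 2 = sqn u.
Proof. by rewrite enormE sqr_sqrtr// sqn_ge0. Qed.

Lemma enormZ a u : 0 <= a -> enorm (a *: u) = a * enorm u.
Proof.
by move=> a0; rewrite !enormE sqnZ sqrtrM ?sqr_ge0// sqrtr_sqr ger0_norm.
Qed.

Lemma sqn_continuous : continuous sqn.
Proof.
rewrite /sqn /dotr => u; apply: (cvg_big (F := nbhs u) add_continuous) => i _.
by apply: cvgM; exact: coord_continuous.
Qed.

End InnerProduct.

(** * Convex hulls and dilates *)

Section Hull.
Variables (R : realType) (n : nat).
Local Notation V := 'rV[R]_n.
Implicit Types (A B S K : set V) (x y z : V).

Definition convex K :=
  forall x y (t : R), K x -> K y -> 0 <= t <= 1 -> K ((1 - t) *: x + t *: y).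

(** Real weights in place of weights bundled with a proof of their bounds. *)
Lemma convex_setE K : @convex_set R V K <-> convex K.
Proof.
split=> [cK x y t Kx Ky /andP[t0 t1]|cK x y t]; last first.
  rewrite !inE => Kx Ky; rewrite /conv /= addrC.
  by apply: cK => //; rewrite ge0 le1.
have h := cK y x (Itv01 t0 t1) (mem_set Ky) (mem_set Kx).
by move/set_mem: h; rewrite /conv /= addrC.
Qed.

Lemma hull_convex S : convex (conv_hull S).
Proof.
apply/convex_setE => x y t; rewrite !inE => Sx Sy K [cK SK].
have := cK x y t (mem_set (Sx K (conj cK SK))) (mem_set (Sy K (conj cK SK))).
exact: set_mem.
Qed.

Lemma sub_hull S : S `<=` conv_hull S.
Proof. exact: sub_gen_smallest. Qed.

Lemma hull_min S K : convex K -> S `<=` K -> conv_hull S `<=` K.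
Proof. by move=> /convex_setE; exact: smallest_sub. Qed.

Lemma hull_sub A B : A `<=` conv_hull B -> conv_hull A `<=` conv_hull B.
Proof. exact: (hull_min (@hull_convex B)). Qed.

Lemma hullS A B : A `<=` B -> conv_hull A `<=` conv_hull B.
Proof. by move=> AB; apply: hull_sub => x /AB; exact: sub_hull. Qed.

Lemma hull0 : conv_hull (@set0 V) = set0.
Proof. by rewrite -subset0; apply: hull_min. Qed.

Lemma hull1 x : conv_hull [set x] = [set x].
Proof.
apply/seteqP; split; last exact: sub_hull.
by apply: hull_min => // _ _ t -> -> _ /=; rewrite -scalerDl subrK scale1r.
Qed.

Lemma convexI A B : convex A -> convex B -> convex (A `&` B).
Proof. by move=> cA cB x y t [Ax Bx] [Ay By] t01; split; [apply: cA|apply: cB]. Qed.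

Lemma halfspace_convex c (b : R) : convex [set x | dotr c x <= b].
Proof.
move=> x y t /= cx cy /andP[t0 t1]; rewrite !dotrE.
have := ler_wpM2l t0 cy; have : 0 <= 1 - t by rewrite subr_ge0.
by move=> /ler_wpM2l /(_ _ _ cx); lra.
Qed.

Lemma open_halfspace_convex c (b : R) : convex [set x | dotr c x < b].
Proof.
move=> x y t /= cx cy /andP[]; rewrite le_eqVlt !dotrE => /predU1P[<-|t0 t1].
  by rewrite subr0 mul1r mul0r addr0.
have := ltr_pM2l t0 (dotr c y) b; rewrite cy => tcy.
have : 0 <= 1 - t by rewrite subr_ge0.
by move=> /ler_wpM2l /(_ _ _ (ltW cx)); lra.
Qed.

Lemma hyperplane_convex c (b : R) : convex [set x | dotr c x = b].
Proof.
by move=> x y t /= cx cy _; rewrite !dotrE cx cy; ring.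
Qed.

(** The dilate [s A], for convex [A] a convex cone in [s] and [X]. The dilate by
    0 is the origin even when [A] is empty, so that convex combinations of two
    sets one of which may be empty need no case analysis. *)
Definition dil A (s : R) (X : V) :=
  0 <= s /\ exists2 x, X = s *: x & (s != 0 -> A x).

Lemma dil0 A : dil A 0 0.
Proof. by split=> //; exists 0; rewrite ?scaler0// eqxx. Qed.

Lemma dil_scale A (s : R) x : 0 <= s -> A x -> dil A s (s *: x).
Proof. by move=> s0 Ax; split=> //; exists x. Qed.

Lemma dil1 A x : dil A 1 x <-> A x.
Proof.
split=> [[_ [y -> Ay]]|Ax]; first by rewrite scale1r; apply: Ay; exact: oner_neq0.
by rewrite -[x]scale1r; exact: dil_scale.
Qed.

Lemma dilZ A (a s : R) X : 0 <= a -> dil A s X -> dil A (a * s) (a *: X).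
Proof.
move=> a0 [s0 [x -> Ax]]; split; first exact: mulr_ge0.
by exists x; rewrite ?scalerA// mulf_eq0 negb_or => /andP[_ /Ax].
Qed.

Lemma dilD A (s t : R) X Y :
  convex A -> dil A s X -> dil A t Y -> dil A (s + t) (X + Y).
Proof.
move=> cA [s0 [x -> Ax]] [t0 [y -> Ay]].
have [->|sn0] := eqVneq s 0.
  by rewrite scale0r !add0r; split=> //; exists y.
have [->|tn0] := eqVneq t 0.
  by rewrite scale0r !addr0; split=> //; exists x.
have st : s + t != 0.
  by rewrite paddr_eq0// negb_and sn0.
split; first exact: addr_ge0.
exists ((1 - t / (s + t)) *: x + (t / (s + t)) *: y).
  rewrite scalerDr !scalerA; congr (_ *: _ + _ *: _); by field.
move=> _; apply: cA; [exact: Ax|exact: Ay|].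
rewrite divr_ge0 ?addr_ge0//= ler_pdivrMr ?mul1r ?lerDr//.
by rewrite lt_neqAle eq_sym st addr_ge0.
Qed.

Lemma hull_setU A B z : conv_hull (A `|` B) z ->
  exists s t X Y, [/\ s + t = 1, dil (conv_hull A) s X,
    dil (conv_hull B) t Y & z = X + Y].
Proof.
move: z; apply: hull_min => [_ _ l [s1 [t1 [X1 [Y1 [st1 dX1 dY1 ->]]]]]
    [s2 [t2 [X2 [Y2 [st2 dX2 dY2 ->]]]]] /andP[l0 l1]|z].
  have l0' : 0 <= 1 - l by rewrite subr_ge0.
  exists ((1 - l) * s1 + l * s2), ((1 - l) * t1 + l * t2).
  exists ((1 - l) *: X1 + l *: X2), ((1 - l) *: Y1 + l *: Y2); split.
  - by move: st1 st2 => /(canRL (addrK _)) -> /(canRL (addrK _)) ->; ring.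
  - by apply: dilD; [exact: hull_convex|exact: dilZ|exact: dilZ].
  - by apply: dilD; [exact: hull_convex|exact: dilZ|exact: dilZ].
  - by rewrite !scalerDr addrACA.
case=> [Az|Bz].
  exists 1, 0, z, 0; split; rewrite ?addr0//; [|exact: dil0].
  by apply/dil1; apply: sub_hull.
exists 0, 1, 0, z; split; rewrite ?add0r//; first exact: dil0.
by apply/dil1; apply: sub_hull.
Qed.

(** Adding a generator [a] replaces the hull by a continuous image of its product
    with a segment. *)
Lemma compact_hull S : finite_set S -> compact (conv_hull S).
Proof.
move=> /finite_seqP[s ->] {S}; elim: s => [|a s ih].
  by rewrite set_nil hull0; exact: compact0.
pose f (p : R * V) := (1 - p.1) *: a + p.1 *: p.2.
have -> : conv_hull [set` a :: s] =
    [set a] `|` f @` (`[0, 1] `*` conv_hull [set` s]).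
  have -> : [set` a :: s] = [set a] `|` [set` s].
    apply/seteqP; split=> x /=; rewrite inE; first by move=> /predU1P.
    by move=> [->|->]; rewrite ?eqxx ?orbT.
  apply/seteqP; split=> [z|z].
    move=> /hull_setU[p [q [X [Y [pq]]]]]; rewrite hull1.
    move=> [p0 [x -> Ax]] [q0 [y -> Ay]] ->.
    have [q00|qn0] := eqVneq q 0.
      left; move: pq; rewrite q00 addr0 => p1.
      by rewrite p1 scale0r addr0 scale1r /=; apply: Ax; rewrite p1 oner_neq0.
    right; exists (q, y); rewrite /f /=.
      split; [rewrite /= in_itv/= q0/=; lra|exact: Ay].
    have -> : 1 - q = p by lra.
    by have [->|/Ax->//] := eqVneq p 0; rewrite !scale0r.
  move=> [->|[[t y] [/=]]]; first by apply: sub_hull; left.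
  rewrite in_itv/= => t01 sy <-; apply: hull_convex => //.
    by apply: sub_hull; left.
  by apply: hullS sy => w; right.
apply: compactU; first exact: compact_set1.
apply: continuous_compact; last first.
  by apply: compact_setX => //; exact: segment_compact.
apply: continuous_subspaceT => p; apply: cvgD; apply: cvgZ => //.
- by apply: cvgB; [exact: cvg_cst|exact: cvg_fst].
- exact: cvg_cst.
- exact: cvg_fst.
- exact: cvg_snd.
Qed.

End Hull.

(** * Nearest points *)

Section Nearest.
Variables (R : realType) (n : nat).
Local Notation V := 'rV[R]_n.
Implicit Types (A B S K : set V) (x y z q : V).

Lemma compact_dist_attained A B : compact A -> compact B ->
  A !=set0 -> B !=set0 ->
  exists x y, [/\ A x, B y &
    forall x' y', A x' -> B y' -> sqn (x - y) <= sqn (x' - y')].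
Proof.
move=> cA cB [a Aa] [b Bb].
have [||[x y] /set_mem/= [Ax By] xymin] :=
    compact_EVT_min (f := fun p : V * V => sqn (p.1 - p.2)) _ (compact_setX cA cB).
- by exists (a, b).
- apply: continuous_subspaceT => p.
  apply: (@continuous_comp _ _ _ (fun p : V * V => p.1 - p.2)).
    by apply: cvgB; [exact: cvg_fst|exact: cvg_snd].
  exact: sqn_continuous.
exists x, y; split=> // x' y' Ax' By'.
by apply: (xymin (x', y')); rewrite inE.
Qed.

(** If the angle at [q] between [y] and [z] were acute, moving [q] slightly
    towards [z] would bring it closer to [y]. *)
Lemma nearest_dotr_le0 K q y z : convex K -> K q -> K z ->
  (forall z', K z' -> sqn (y - q) <= sqn (y - z')) ->
  dotr (y - q) (z - q) <= 0.
Proof.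
move=> cK Kq Kz qmin; rewrite leNgt; apply/negP => D0.
set D := dotr _ _ in D0; set N := sqn (z - q).
have N0 : 0 <= N by exact: sqn_ge0.
have DN : 0 < D + N by lra.
(* the step D / (D + N) from q towards z strictly decreases the distance *)
pose s := D / (D + N).
have s0 : 0 < s by rewrite divr_gt0.
have s1 : s <= 1 by rewrite ler_pdivrMr// mul1r lerDl.
have sDN : s * (D + N) = D by rewrite /s divfK// gt_eqF.
have /qmin : K ((1 - s) *: q + s *: z) by apply: cK; rewrite // ltW.
have -> : y - ((1 - s) *: q + s *: z) = (y - q) - s *: (z - q).
  by apply/rowP => i; rewrite !mxE; ring.
have -> : sqn ((y - q) - s *: (z - q)) = sqn (y - q) - 2 * s * D + s ^+ 2 * N.
  by rewrite /N /D /sqn !dotrE (dotrC z y) (dotrC q y) (dotrC z q); ring.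
have : s * (s * N) < s * (2 * D) by rewrite ltr_pM2l//; nra.
by rewrite expr2; lra.
Qed.

Lemma nearest_point S y : finite_set S -> conv_hull S !=set0 ->
  exists q, [/\ conv_hull S q,
    forall z, conv_hull S z -> sqn (y - q) <= sqn (y - z) &
    forall z, conv_hull S z -> dotr (y - q) z <= dotr (y - q) q].
Proof.
move=> fS S0.
have [|x [q [-> Sq qmin]]] := compact_dist_attained (@compact_set1 _ y)
  (compact_hull fS) _ S0; first by exists y.
have {}qmin z : conv_hull S z -> sqn (y - q) <= sqn (y - z) by exact: qmin.
exists q; split=> // z Sz.
have := nearest_dotr_le0 (@hull_convex _ _ S) Sq Sz qmin.
by rewrite dotrDr dotrNr subr_le0.
Qed.

(** Hulls of finite sets are closed, in a metric form. *)
Lemma hull_gap S y : finite_set S -> ~ conv_hull S y ->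
  exists2 r, 0 < r & forall z, conv_hull S z -> r <= sqn (y - z).
Proof.
move=> fS Sy; have [S0|/set0P/negP/negPn/eqP->] := pselect (conv_hull S !=set0).
  have [q [Sq qmin _]] := nearest_point y fS S0.
  exists (sqn (y - q)) => //; apply: sqn_gt0; apply/eqP => /eqP.
  by rewrite subr_eq0 => /eqP yq; apply: Sy; rewrite yq.
by exists 1.
Qed.

End Nearest.

(** * Faces and vertices *)

Section Faces.
Variables (R : realType) (n : nat).
Local Notation V := 'rV[R]_n.
Implicit Types (A B S P F G : set V) (x y z c : V) (b : R).

Lemma face_sub P F : face P F -> F `<=` P.
Proof. by move=> [c [b [_ ->]]] x []. Qed.

Lemma face_self P : face P P.
Proof.
exists 0, 0; split=> [x _|]; first by rewrite dotr0l.
by apply/esym/setIidPl => x _ /=; rewrite dotr0l.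
Qed.

Lemma hullD_lt S c b y : (forall x, conv_hull S x -> dotr c x <= b) ->
  conv_hull (S `\` (conv_hull S `&` [set x | dotr c x = b])) y -> dotr c y < b.
Proof.
move=> cb; move: y; apply: hull_min; first exact: open_halfspace_convex.
move=> x [Sx xF] /=; rewrite lt_neqAle cb ?andbT; last exact: sub_hull.
by apply/eqP => cx; apply: xF; split=> //; exact: sub_hull.
Qed.

(** In a convex combination of points of [S] on which a valid inequality is
    tight, the points where it is strict carry no weight. *)
Lemma face_hull S F : face (conv_hull S) F -> F = conv_hull (S `&` F).
Proof.
move=> [c [b [cb FE]]]; apply/seteqP; split; last first.
  apply: hull_min => [|x []//].
  by rewrite FE; apply: convexI; [exact: hull_convex|exact: hyperplane_convex].
move=> x; rewrite {1}FE => -[Sx cx].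
have : conv_hull ((S `&` F) `|` (S `\` F)) x by rewrite setUIDK.
move=> /hull_setU[s [t [X [Y [st [s0 [u -> Fu]] [t0 [v -> Fv]] xE]]]]].
have [t00|tn0] := eqVneq t 0.
  have s1 : s = 1 by rewrite -st t00 addr0.
  by rewrite xE t00 s1 scale0r addr0 scale1r; apply: Fu; rewrite s1 oner_neq0.
have cv : dotr c v < b by apply: (hullD_lt cb); rewrite -FE; exact: Fv.
have cu : s * dotr c u <= s * b.
  have [->|sn0] := eqVneq s 0; first by rewrite !mul0r.
  by apply: ler_wpM2l => //; apply: cb; apply: hullS (Fu sn0) => ? [].
have ct : t * dotr c v < t * b by rewrite ltr_pM2l// lt_neqAle eq_sym tn0.
move: cx => /=; rewrite xE !dotrE => cx.
have : b = s * b + t * b by rewrite -mulrDl st mul1r.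
by lra.
Qed.

(** A face is determined by the generators that it contains. *)
Lemma finite_faces S : finite_set S -> finite_set [set F | face (conv_hull S) F].
Proof.
move=> /finite_seqP[s ->].
apply: (@sub_finite_set _ _
  ((fun m : (size s).-tuple bool => conv_hull [set` mask m s]) @` setT)).
  move=> F /face_hull ->; exists (map_tuple (fun v => `[< F v >]) (in_tuple s)) => //=.
  rewrite -filter_mask; congr conv_hull; apply/seteqP; split=> x /=.
    by rewrite mem_filter => /andP[/asboolP].
  by move=> [xs Fx]; rewrite mem_filter xs andbT; apply/asboolP.
exact/finite_image/finite_finset.
Qed.

Lemma vertices_hull_sub S : vertices (conv_hull S) `<=` S.
Proof.
move=> v /= /face_hull vE; apply: contrapT => Sv.
have : [set v] v by [].
rewrite vE (_ : S `&` [set v] = set0) ?hull0// -subset0 => x [Sx xv].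
by apply: Sv; rewrite -xv.
Qed.

(** Minkowski's theorem for exposed points: a point of a minimal generating set
    is strictly separated from the hull of the others by its nearest point
    there, hence it is a vertex. *)
Lemma hull_vertices S : finite_set S ->
  conv_hull (vertices (conv_hull S)) = conv_hull S.
Proof.
move=> /finite_seqP[s ->] {S}; move: {2}(size s) (leqnn (size s)) => k.
elim: k s => [|k ih] s.
  rewrite leqn0 size_eq0 => /eqP->; rewrite set_nil hull0.
  rewrite (_ : vertices set0 = set0) ?hull0// -subset0 => v /face_sub; exact.
move=> sk.
have [[v sv vhull]|ext] := pselect (exists2 v, v \in s &
    conv_hull ([set` s] `\ v) v).
  have E : [set` s] `\ v = [set` [seq x <- s | x != v]].
    apply/seteqP; split=> x /=; rewrite mem_filter /=.
      by move=> [-> /eqP ->].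
    by move=> /andP[/eqP xv ->].
  have -> : conv_hull [set` s] = conv_hull [set` [seq x <- s | x != v]].
    rewrite -E; apply/seteqP; split; last by apply: hullS => x [].
    apply: hull_sub => x sx; have [->//|xv] := eqVneq x v.
    by apply: sub_hull; split=> //; exact/eqP.
  apply: ih; rewrite size_filter -ltnS (leq_trans _ sk)//.
  rewrite ltn_neqAle count_size andbT -all_count; apply/negP => /allP /(_ v sv).
  by rewrite /= eqxx.
apply/seteqP; split; first by apply: hullS; exact: vertices_hull_sub.
apply: hullS => v sv /=.
have sE : [set` s] = [set v] `|` ([set` s] `\ v) by rewrite setD1K.
have [S0|/set0P/negP/negPn/eqP S0] := pselect (conv_hull ([set` s] `\ v) !=set0).
  have fS : finite_set ([set` s] `\ v).
    by apply: sub_finite_set (finite_seq s) => x [].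
  have [q [Sq qmin qmax]] := nearest_point v fS S0.
  have cv : dotr (v - q) q < dotr (v - q) v.
    rewrite -subr_gt0 -dotrNr -dotrDr; apply: sqn_gt0; rewrite subr_eq0.
    by apply/eqP => vq; apply: ext; exists v => //; rewrite {2}vq.
  have valid x : conv_hull [set` s] x -> dotr (v - q) x <= dotr (v - q) v.
    move: x; apply: hull_min; first exact: halfspace_convex.
    move=> x; rewrite sE => -[->//|sx] /=; apply: ltW; apply: le_lt_trans cv.
    by apply: qmax; exact: sub_hull.
  have fF : face (conv_hull [set` s])
      (conv_hull [set` s] `&` [set x | dotr (v - q) x = dotr (v - q) v]).
    by exists (v - q), (dotr (v - q) v).
  rewrite /vertices /= (_ : [set v] = conv_hull [set` s] `&`
      [set x | dotr (v - q) x = dotr (v - q) v])//.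
  rewrite (face_hull fF) -[LHS]hull1; congr conv_hull.
  apply/seteqP; split=> [_ ->|x [sx [_ /= cx]]].
    by split=> //; split=> //; exact: sub_hull.
  apply: contrapT => xv; have := qmax x; rewrite cx leNgt cv => /(_ _)/negP.
  by apply => //; apply: sub_hull; split.
have -> : conv_hull [set` s] = [set v].
  rewrite sE (_ : [set` s] `\ v = set0) ?setU0 ?hull1//.
  by rewrite -subset0 -S0; exact: sub_hull.
exact: face_self.
Qed.

Lemma polytope_vertices P : polytope P ->
  finite_set (vertices P) /\ P = conv_hull (vertices P).
Proof.
move=> [S fS ->]; split; last by rewrite hull_vertices.
exact: sub_finite_set (@vertices_hull_sub S) fS.
Qed.

Lemma common_bound (T : eqType) (s : seq T) (Pr : T -> R -> Prop) :
  (forall i, i \in s ->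
     exists2 e, 0 < e & forall e', 0 < e' -> e' <= e -> Pr i e') ->
  exists2 e, 0 < e &
    forall e', 0 < e' -> e' <= e -> forall i, i \in s -> Pr i e'.
Proof.
move=> H; elim: s H => [|i s ih] H; first by exists 1.
have [j js|e1 e10 H1] := ih; first by apply: H; rewrite inE js orbT.
have [|e2 e20 H2] := H i; first by rewrite inE eqxx.
exists (Num.min e1 e2) => [|e' e'0]; first by rewrite lt_min e10.
rewrite le_min => /andP[ee1 ee2] j; rewrite inE => /predU1P[->|js].
  exact: H2.
exact: H1.
Qed.

(** If [c1 <= b1] cuts out [F] and [c2 <= b2] cuts out [G] from [F], then for
    small [e > 0] the inequality [c1 + e c2 <= b1 + e b2] cuts out [G]: it
    remains strict at the finitely many generators outside [F]. *)
Lemma face_trans S F G : finite_set S ->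
  face (conv_hull S) F -> face F G -> face (conv_hull S) G.
Proof.
move=> fS faceF [c2 [b2 [valid2 GE]]].
have [c1 [b1 [valid1 FE]]] := faceF.
have [s sE] := (finite_seqP S).1 fS.
have [e e0 He] : exists2 e, 0 < e & forall v, v \in s ->
    ~ F v -> dotr (c1 + e *: c2) v < b1 + e * b2.
  suff [e e0 He] : exists2 e, 0 < e & forall e', 0 < e' -> e' <= e ->
      forall v, v \in s -> ~ F v -> dotr (c1 + e' *: c2) v < b1 + e' * b2.
    by exists e => //; exact: He.
  apply: common_bound => v sv.
  have [Fv|Fv] := pselect (F v); first by exists 1.
  have Pv : conv_hull S v by apply: sub_hull; rewrite sE.
  have c1v : 0 < b1 - dotr c1 v.
    rewrite subr_gt0 lt_neqAle valid1// andbT; apply/eqP => cv.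
    by apply: Fv; rewrite FE.
  pose N := `|dotr c2 v - b2| + 1.
  have N0 : 0 < N by rewrite /N ltr_wpDl.
  exists ((b1 - dotr c1 v) / N) => [|e e0 eN _]; first exact: divr_gt0.
  rewrite !dotrE; move: eN; rewrite ler_pdivlMr// => eN.
  have : e * (dotr c2 v - b2) < e * N.
    by rewrite ltr_pM2l// (le_lt_trans (ler_norm _))// /N ltrDl.
  by lra.
have valid x : conv_hull S x -> dotr (c1 + e *: c2) x <= b1 + e * b2.
  move: x; apply: hull_min; first exact: halfspace_convex.
  move=> v Sv /=; have [Fv|Fv] := pselect (F v).
    have : dotr c1 v <= b1 by apply: valid1; exact: sub_hull.
    by have /(ler_wpM2l (ltW e0)) := valid2 _ Fv; rewrite !dotrE; lra.
  by apply: ltW; apply: He => //; move: Sv; rewrite sE.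
exists (c1 + e *: c2), (b1 + e * b2); split=> //.
set H := _ `&` _.
have faceH : face (conv_hull S) H by exists (c1 + e *: c2), (b1 + e * b2).
apply/seteqP; split=> [x|].
  rewrite GE FE => -[[Px /= c1x] c2x]; split=> //=.
  by rewrite !dotrE c1x c2x.
have cvxG : convex G.
  rewrite GE FE; do 2 (apply: convexI; last exact: hyperplane_convex).
  exact: hull_convex.
rewrite (face_hull faceH); apply: hull_min => // v [Sv [Pv /= cv]].
have Fv : F v.
  have vs : v \in s by move: Sv; rewrite sE.
  by apply: contrapT => Fv; have := He v vs Fv; rewrite cv ltxx.
rewrite GE; split=> //=; move: (Fv) cv; rewrite FE => -[_ /= c1v].
by rewrite !dotrE c1v => /addrI/(mulfI (lt0r_neq0 e0)).
Qed.

End Faces.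

(** * Attained distances and the pyramidal width *)

Section Width.
Variables (R : realType) (n : nat).
Local Notation V := 'rV[R]_n.
Implicit Types (A B S P F G : set V) (x y z c : V) (m : R).

Lemma minimumE (S : set R) m : S m -> lbound S m -> minimum S = m.
Proof.
move=> Sm Lm; have [//|Sk Lk] := @xgetPex _ 0 (S `&` lbound S); first by exists m.
by apply/le_anti; rewrite Lk// Lm.
Qed.

Lemma edist_attained A B : compact A -> compact B -> A !=set0 -> B !=set0 ->
  exists x y, [/\ A x, B y, Defs.edist A B = enorm (x - y) &
    forall x' y', A x' -> B y' -> Defs.edist A B <= enorm (x' - y')].
Proof.
move=> cA cB A0 B0; have [x [y [Ax By xymin]]] := compact_dist_attained cA cB A0 B0.
have {}xymin x' y' : A x' -> B y' -> enorm (x - y) <= enorm (x' - y').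
  by move=> Ax' By'; rewrite !enormE ler_wsqrtr// xymin.
have E : Defs.edist A B = enorm (x - y).
  apply: minimumE; first by exists x => //; exists y.
  by move=> _ [x' Ax' [y' By' <-]]; exact: xymin.
by exists x, y; split=> // x' y' Ax' By'; rewrite E xymin.
Qed.

Lemma finite_minimum (S : set R) : finite_set S -> S !=set0 ->
  exists2 m, S m & lbound S m.
Proof.
move=> /finite_compact cS S0.
have [|m Sm Lm] := compact_EVT_min (f := @id R) S0 cS.
  by apply: continuous_subspaceT => x; exact: cvg_id.
exists m; first exact: set_mem.
by move=> t St; apply: Lm; exact: mem_set.
Qed.

Definition width_lbound P m := forall F x a, proper_faces P F ->
  F x -> conv_hull (vertices P `\` F) a -> m <= enorm (x - a).

Definition width_attained P m := exists F x a, [/\ proper_faces P F,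
  F x, conv_hull (vertices P `\` F) a & m = enorm (x - a)].

(** This allows the pyramidal width to be computed from a bound and a pair of
    points, without evaluating the two nested minima that define it. *)
Lemma width_unique P m m' : width_lbound P m -> width_attained P m ->
  width_lbound P m' -> width_attained P m' -> m = m'.
Proof.
move=> Lm [F [x [a [pF Fx Fa mE]]]] Lm' [G [y [b [pG Gy Gb m'E]]]].
apply/le_anti/andP; split.
  by rewrite m'E; exact: Lm pG Gy Gb.
by rewrite mE; exact: Lm' pF Fx Fa.
Qed.

Lemma face_compact P F : polytope P -> face P F -> compact F.
Proof.
move=> [S fS ->] /face_hull ->; apply: compact_hull.
by apply: sub_finite_set fS => x [].
Qed.

Lemma proper_face_hullD P F : polytope P -> proper_faces P F ->
  conv_hull (vertices P `\` F) !=set0.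
Proof.
move=> polP [faceF F0 FP]; have [fV PE] := polytope_vertices polP.
apply: contrapT => VF; apply: FP; apply/seteqP; split; first exact: face_sub.
rewrite {1}PE; have : face (conv_hull (vertices P)) F by rewrite -PE.
move=> /face_hull ->; apply: hullS => v Pv; split=> //.
by apply: contrapT => Fv; apply: VF; exists v; apply: sub_hull.
Qed.

Lemma pyramidal_width_spec P : polytope P -> proper_faces P !=set0 ->
  width_lbound P (pyramidal_width P) /\ width_attained P (pyramidal_width P).
Proof.
move=> polP P0; have [fV PE] := polytope_vertices polP.
have att F : proper_faces P F -> exists x y, [/\ F x,
    conv_hull (vertices P `\` F) y,
    Defs.edist F (conv_hull (vertices P `\` F)) = enorm (x - y) &
    forall x' y', F x' -> conv_hull (vertices P `\` F) y' ->
      Defs.edist F (conv_hull (vertices P `\` F)) <= enorm (x' - y')].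
  move=> pF; have [faceF /eqP/set0P F0 _] := pF; apply: edist_attained => //.
  - exact: face_compact faceF.
  - by apply: compact_hull; apply: sub_finite_set fV => x [].
  - exact: proper_face_hullD.
set W := [set Defs.edist F (conv_hull (vertices P `\` F)) | F in proper_faces P].
have [||m Wm Lm] := @finite_minimum W.
- apply: finite_image; have [S fS PS] := polP.
  by apply: sub_finite_set (finite_faces fS) => F [] /=; rewrite PS.
- exact: image_nonempty.
have -> : pyramidal_width P = m by exact: minimumE.
split.
  move=> F x a pF Fx Fa; have [_ [_ [_ _ _ /(_ x a Fx Fa)]]] := att F pF.
  by apply: le_trans; apply: Lm; exists F.
case: Wm => F pF <-; have [x [a [Fx Fa E _]]] := att F pF.
by exists F, x, a.
Qed.

(** * The width bounds the distance between dilates *)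

(** Let [p r = y + r (x - y)] leave the polytope at the parameter [r]. The point
    [q] nearest to [p (r + d)], and the face [G] that the direction
    [c = p (r + d) - q] cuts out at [q], satisfy:
    - [G] is proper: if [c] were constant on the polytope, hence on the line
      through [x] and [y], then [dotr c c] would vanish;
    - [q] tends to [p r] as [d] tends to 0, so the distance from [p r] to [G] does
      too; as there are finitely many faces, all of them closed, [G] contains
      [p r] once [d] is small. *)
Lemma ray_exit S x y (T : R) : finite_set S ->
  conv_hull S x -> conv_hull S y -> 1 <= T ->
  ~ conv_hull S (y + T *: (x - y)) ->
  exists r G, [/\ 1 <= r < T, face (conv_hull S) G, G <> conv_hull S &
    G (y + r *: (x - y))].
Proof.
move=> fS Sx Sy T1 ST; pose p r := y + r *: (x - y).
set N := sqn (x - y) + 1.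
have N0 : 0 < N by rewrite ltr_wpDl// sqn_ge0.
have sqp r r' : sqn (p r - p r') <= (r - r') ^+ 2 * N.
  have -> : p r - p r' = (r - r') *: (x - y).
    by apply/rowP => i; rewrite !mxE; ring.
  by rewrite sqnZ ler_wpM2l ?sqr_ge0// /N lerDl.
pose I := [set r | 1 <= r <= T /\ conv_hull S (p r)].
have I1 : I 1.
  by split; rewrite ?lexx// /p scale1r addrC subrK.
have supI : has_sup I by split; [exists 1|exists T => r [/andP[]]].
set r := sup I.
have r1 : 1 <= r by apply: ub_le_sup => //; case: supI.
have rT : r <= T by apply: ge_sup => [|s [/andP[]]]//; exists 1.
have Sr : conv_hull S (p r).
  apply: contrapT => /(hull_gap fS)[e e0 He].
  have d0 : 0 < Num.min 1 (e / N) by rewrite lt_min ltr01 divr_gt0.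
  have [s Is] := sup_adherent d0 supI; rewrite -/r => rs.
  have sr : s <= r by apply: ub_le_sup => //; case: supI.
  have {rs} : r - s < Num.min 1 (e / N) by lra.
  rewrite lt_min ltr_pdivlMr// => /andP[rs1 rsN].
  have := le_trans (He _ Is.2) (sqp r s); rewrite expr2 -mulrA.
  have : (r - s) * ((r - s) * N) <= 1 * ((r - s) * N).
    by rewrite ler_wpM2r ?mulr_ge0 ?(ltW N0) ?(ltW rs1)// subr_ge0.
  by lra.
have {}rT : r < T.
  by rewrite lt_neqAle rT andbT; apply/eqP => E; apply: ST; rewrite -E.
have /finite_seqP[s sE] := finite_faces fS.
(* faces missing p r stay away from it by more than twice the length of the step *)
have [e e0 He] : exists2 e, 0 < e & forall e', 0 < e' -> e' <= e ->
    forall G, G \in s -> ~ G (p r) ->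
      forall z, G z -> 4 * (e' ^+ 2 * N) < sqn (p r - z).
  apply: common_bound => G Gs; have [Gr|Gr] := pselect (G (p r)).
    by exists 1.
  have faceG : face (conv_hull S) G by have : [set` s] G by []; rewrite -sE.
  have fG : finite_set (S `&` G) by apply: sub_finite_set fS => z [].
  have GE := face_hull faceG.
  have [|g g0 Hg] := @hull_gap _ _ _ (p r) fG; first by rewrite -GE.
  have d0 : 0 < Num.min 1 (g / (8 * N)).
    by rewrite lt_min ltr01 divr_gt0// mulr_gt0.
  exists (Num.min 1 (g / (8 * N))) => // e e0.
  rewrite le_min ler_pdivlMr ?mulr_gt0// => /andP[e1 eN] _ z.
  rewrite {1}GE => /Hg; apply: lt_le_trans.
  have : e * (e * N) <= 1 * (e * N) by rewrite ler_wpM2r// mulr_ge0 ?ltW.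
  by rewrite expr2; lra.
pose d := Num.min e (T - r).
have d0 : 0 < d by rewrite lt_min e0 subr_gt0.
set u := p (r + d).
have Su : ~ conv_hull S u.
  move=> Su; have : r + d <= r.
    apply: ub_le_sup; first by case: supI.
    split=> //; apply/andP; split; first by lra.
    by rewrite -lerBrDl ge_min lexx orbT.
  by lra.
have [q [Sq qmin qmax]] := nearest_point u fS (ex_intro _ x Sx).
pose G := conv_hull S `&` [set z | dotr (u - q) z = dotr (u - q) q].
have faceG : face (conv_hull S) G by exists (u - q), (dotr (u - q) q).
exists r, G; split=> //; first by rewrite r1.
- move=> GE; apply: Su.
  have [_ /= cx] : G x by rewrite GE.
  have [_ /= cy] : G y by rewrite GE.
  suff : u - q = 0 by move/eqP; rewrite subr_eq0 => /eqP ->.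
  apply: sqn_eq0; rewrite {1}/sqn dotrDr dotrNr {1}/u /p.
  by rewrite !(dotrDr, dotrNr, dotrZr) cx cy; ring.
- apply: contrapT => Gr; have Gs : G \in s by have : [set` s] G by rewrite -sE.
  have := He d d0 _ G Gs Gr q (conj Sq erefl).
  rewrite ge_min lexx => /(_ isT).
  have uq := le_trans (qmin _ Sr) (sqp (r + d) r).
  have := sqnD_le (p r - u) (u - q); rewrite addrA subrK.
  move: (sqp r (r + d)) uq; rewrite -/u.
  have -> : (r - (r + d)) ^+ 2 = d ^+ 2 by ring.
  have -> : (r + d - r) ^+ 2 = d ^+ 2 by ring.
  by lra.
Qed.

End Width.

Section Dilates.
Variables (R : realType) (n : nat).
Local Notation V := 'rV[R]_n.
Implicit Types (A B S P F G : set V) (x y z c : V) (m : R).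

Lemma dil_face_split P F (r : R) Y : polytope P -> face P F -> dil P r Y ->
  exists r1 r2 Y1 Y2, [/\ r1 + r2 = r, dil F r1 Y1,
    dil (conv_hull (vertices P `\` F)) r2 Y2 & Y = Y1 + Y2].
Proof.
move=> polP faceF [r0 [y -> Py]]; have [fV PE] := polytope_vertices polP.
have [->|rn0] := eqVneq r 0.
  by exists 0, 0, 0, 0; split; rewrite ?scale0r ?addr0//; exact: dil0.
have : conv_hull ((vertices P `&` F) `|` (vertices P `\` F)) y.
  by rewrite setUIDK -PE; exact: Py.
have FE : F = conv_hull (vertices P `&` F) by apply: face_hull; rewrite -PE.
move=> /hull_setU[s [t [Y1 [Y2 [st dY1 dY2 ->]]]]].
exists (r * s), (r * t), (r *: Y1), (r *: Y2); split.
- by rewrite -mulrDr st mulr1.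
- by apply: dilZ; rewrite // FE.
- exact: dilZ.
- by rewrite scalerDr.
Qed.

(** Only [s = 1] is used in the end, but general weights let the induction go
    through without renormalizing. The points [X] and [Y] may both be
    taken in dilates of [F], since moving the remaining part of [Y] into [Z] only
    increases [t]; write [X = s x] and [Y = r y].
    If [X - Y] lies in [t F], the bound [m] for the face [F] applies directly.
    Otherwise the ray from [y] through [x] leaves [F] in a smaller face [G], at
    a point [p = y + rho (x - y)] with [rho < s / t], and
    [X - Y = (s / rho) p - (s / rho - t) y]. This is the same situation for [G],
    with the same [t] and [Z], and fewer vertices lie in [G]: conclude by
    induction on the number of vertices in the face. *)
Lemma dilate_dist P m : polytope P -> 0 <= m -> width_lbound P m ->
  forall F (s r t : R) X Y Z, face P F -> s = r + t ->
  dil F s X -> dil P r Y -> dil (conv_hull (vertices P `\` F)) t Z ->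
  t * m <= enorm (X - (Y + Z)).
Proof.
move=> polP m0 Lm; have [fV PE] := polytope_vertices polP.
have /finite_seqP[vs vsE] := fV.
move=> F; move: {2}(size [seq v <- vs | `[< F v >]]).+1
  (ltnSn (size [seq v <- vs | `[< F v >]])) => k.
elim: k F => // k ih F Fk s r' t' X Y' Z' faceF sE dX dY' dZ'.
have [r [t0 [Y [Z0 [rE dY dZ0 YE]]]]] := dil_face_split polP faceF dY'.
have [t tE [Z ZE dZ]] : exists2 t, t = t0 + t' & exists2 Z, Z = Z0 + Z' &
    dil (conv_hull (vertices P `\` F)) t Z.
  exists (t0 + t') => //; exists (Z0 + Z') => //.
  by apply: dilD => //; exact: hull_convex.
have {}sE : s = r + t by rewrite tE addrA rE.
have -> : X - (Y' + Z') = X - (Y + Z) by rewrite YE ZE addrA.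
have t0' : t' <= t by rewrite tE lerDr; case: dZ0.
apply: (le_trans (ler_wpM2r m0 t0')).
move: dX dY dZ => [s0 [x -> Fx]] [r0 [y -> Fy]] [tge0 [z -> Vz]].
have [->|tn0] := eqVneq t 0; first by rewrite mul0r enorm_ge0.
have tgt0 : 0 < t by rewrite lt_neqAle eq_sym tn0.
have {}Vz := Vz tn0.
have sn0 : s != 0 by rewrite gt_eqF// sE ltr_wpDl.
have {}Fx := Fx sn0.
(* the bound for the face F itself, which is proper because z exists *)
have direct x' : F x' -> t * m <= enorm (t *: x' - t *: z).
  move=> Fx'; rewrite -scalerBr enormZ// ler_pM2l//.
  apply: (Lm F) => //; split=> //; first by move=> F0; rewrite F0 in Fx.
  move=> FP; move: Vz; rewrite FP (_ : vertices P `\` P = set0) ?hull0//.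
  by rewrite -subset0 => v [/face_sub vP]; apply; exact: vP.
have [r00|rn0] := eqVneq r 0.
  by rewrite r00 scale0r add0r sE r00 add0r; exact: direct.
have {}Fy := Fy rn0.
have FE : F = conv_hull (vertices P `&` F) by apply: face_hull; rewrite -PE.
have fF : finite_set (vertices P `&` F) by apply: sub_finite_set fV => v [].
have [FT|FT] := pselect (F (y + (s / t) *: (x - y))).
  have := direct _ FT; congr (_ <= enorm _).
  by apply/rowP => i; rewrite !mxE sE; field.
have T1 : 1 <= s / t by rewrite ler_pdivlMr// mul1r sE lerDr.
have [|||rho [G [/andP[rho1 rhoT] faceG GF Grho]]] :=
  @ray_exit _ _ (vertices P `&` F) x y _ fF _ _ T1; rewrite -?FE//.
rewrite -FE in faceG GF.
have rho0 : 0 < rho by exact: lt_le_trans rho1.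
have PG : face P G by move: faceF faceG; rewrite PE; exact: face_trans.
have -> : s *: x - (r *: y + t *: z) =
    (s / rho) *: (y + rho *: (x - y)) - ((s / rho - t) *: y + t *: z).
  by apply/rowP => i; rewrite !mxE sE; field; rewrite gt_eqF.
have srho : t <= s / rho.
  by move: rhoT; rewrite ltr_pdivlMr// ler_pdivlMr// mulrC; exact: ltW.
apply: (ih G _ _ _ _ _ _ _ PG (esym (subrK _ _))).
- rewrite -ltnS (leq_trans _ Fk)// ltnS.
  have -> : [seq v <- vs | `[< G v >]] =
      [seq v <- [seq v <- vs | `[< F v >]] | `[< G v >]].
    rewrite -filter_predI; apply: eq_in_filter => v _ /=.
    apply/asboolP/andP => [Gv|[/asboolP//]]; split; apply/asboolP => //.
    exact: face_sub faceG _ Gv.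
  rewrite size_filter ltn_neqAle count_size andbT -all_count.
  apply/negP => /allP GFv; apply: GF; apply/seteqP; split; first exact: face_sub.
  rewrite FE (face_hull (F := G) (S := vertices P)) -?PE//.
  apply: hullS => v [Pv Fv]; split=> //; apply/asboolP/GFv.
  by rewrite mem_filter; apply/andP; split; [exact/asboolP|move: Pv; rewrite vsE].
- by apply: dil_scale => //; rewrite divr_ge0// ltW.
- apply: dil_scale; rewrite ?subr_ge0//; exact: face_sub faceF _ Fy.
- apply: dil_scale => //; apply: hullS Vz => v [Pv Fv]; split=> // Gv.
  exact/Fv/(face_sub faceG).
Qed.

End Dilates.

(** * Cartesian products *)

Section Product.
Variables (R : realType) (m n : nat).
Implicit Types (P F A S : set 'rV[R]_m) (Q G B T : set 'rV[R]_n).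

Lemma dotr_row_mx (c x : 'rV[R]_m) (d y : 'rV[R]_n) :
  dotr (row_mx c d) (row_mx x y) = dotr c x + dotr d y.
Proof.
by rewrite /dotr big_split_ord; congr (_ + _); apply: eq_bigr => i _;
  rewrite ?row_mxEl ?row_mxEr.
Qed.

Lemma cart_prodE P Q x y : cart_prod P Q (row_mx x y) <-> P x /\ Q y.
Proof.
split=> [[x' Px' [y' Qy' /eq_row_mx[<- <-]]]|[Px Qy]]; first by [].
by exists x => //; exists y.
Qed.

Lemma cart_prodS P P' Q Q' : P `<=` P' -> Q `<=` Q' ->
  cart_prod P Q `<=` cart_prod P' Q'.
Proof. by move=> PP' QQ' _ [x /PP' Px [y /QQ' Qy <-]]; exact/cart_prodE. Qed.

Lemma convex_cart P Q : convex P -> convex Q -> convex (cart_prod P Q).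
Proof.
move=> cP cQ _ _ t [x Px [y Qy <-]] [x' Px' [y' Qy' <-]] t01.
rewrite !scale_row_mx add_row_mx; apply/cart_prodE.
by split; [apply: cP|apply: cQ].
Qed.

Lemma hull_cart S T :
  conv_hull (cart_prod S T) = cart_prod (conv_hull S) (conv_hull T).
Proof.
apply/seteqP; split.
  apply: hull_min; first by apply: convex_cart; exact: hull_convex.
  by apply: cart_prodS; exact: sub_hull.
move=> _ [x Sx [y Ty <-]]; have {}Sx y' : T y' ->
    conv_hull (cart_prod S T) (row_mx x y').
  move=> Ty'; move: x Sx; apply: hull_min => [x1 x2 t h1 h2 t01|x Sx].
    have := hull_convex h1 h2 t01.
    by rewrite !scale_row_mx add_row_mx -scalerDl subrK scale1r.
  by apply: sub_hull; exact/cart_prodE.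
move: y Ty; apply: hull_min => [y1 y2 t h1 h2 t01|//].
have := hull_convex h1 h2 t01.
by rewrite !scale_row_mx add_row_mx -scalerDl subrK scale1r.
Qed.

Lemma polytope_cart P Q : polytope P -> polytope Q -> polytope (cart_prod P Q).
Proof.
move=> [S fS ->] [T fT ->]; exists (cart_prod S T); last by rewrite hull_cart.
exact: finite_image2.
Qed.

Lemma face_cart P Q F G : face P F -> face Q G ->
  face (cart_prod P Q) (cart_prod F G).
Proof.
move=> [c [b [cb FE]]] [d [e [de GE]]]; exists (row_mx c d), (b + e); split.
  by move=> _ [x Px [y Qy <-]]; rewrite dotr_row_mx lerD ?cb ?de.
apply/seteqP; split=> [_ [x Fx [y Gy <-]]|_ [[x Px [y Qy <-]]] /=].
  move: Fx Gy; rewrite FE GE => -[Px /= cx] [Qy /= dy].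
  by split; [exact/cart_prodE|rewrite /= dotr_row_mx cx dy].
rewrite dotr_row_mx => cd; apply/cart_prodE; rewrite FE GE.
have := cb x Px; have := de y Qy => dy cx.
by do 2 split=> //=; apply/le_anti/andP; split=> //; lra.
Qed.

(** A linear functional on a product is maximized coordinatewise, so the maxima
    over the two factors describe its maximal face. *)
Lemma face_cart_inv P Q H : face (cart_prod P Q) H -> H <> set0 ->
  exists F G, [/\ face P F, face Q G & H = cart_prod F G].
Proof.
move=> [c [b []]]; rewrite -(hsubmxK c).
move: (lsubmx c) (rsubmx c) => c1 c2 valid HE /eqP/set0P[w].
rewrite {1}HE => -[[x0 Px0 [y0 Qy0 <-]] /=]; rewrite dotr_row_mx => cw.
have v1 x : P x -> dotr c1 x <= dotr c1 x0.
  by move=> Px; have := valid (row_mx x y0);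
    rewrite cart_prodE dotr_row_mx => /(_ (conj Px Qy0)); lra.
have v2 y : Q y -> dotr c2 y <= dotr c2 y0.
  by move=> Qy; have := valid (row_mx x0 y);
    rewrite cart_prodE dotr_row_mx => /(_ (conj Px0 Qy)); lra.
exists (P `&` [set x | dotr c1 x = dotr c1 x0]).
exists (Q `&` [set y | dotr c2 y = dotr c2 y0]); split.
- by exists c1, (dotr c1 x0).
- by exists c2, (dotr c2 y0).
rewrite HE; apply/seteqP; split=> [_ [[x Px [y Qy <-]]] /=|z].
  rewrite dotr_row_mx => cxy; apply/cart_prodE.
  have := v1 x Px; have := v2 y Qy => cy cx.
  by do 2 split=> //=; apply/le_anti/andP; split=> //; lra.
move=> [x [Px /= cx] [y [Qy /= cy] <-]] {z}; split; first exact/cart_prodE.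
by rewrite /= dotr_row_mx cx cy.
Qed.

Lemma vertices_cart P Q :
  vertices (cart_prod P Q) = cart_prod (vertices P) (vertices Q).
Proof.
have set1E u v : [set row_mx u v] = cart_prod [set u] [set v] :> set 'rV[R]_(m + n).
  apply/seteqP; split=> [_ ->|_ [_ -> [_ -> <-]]//]; exact/cart_prodE.
apply/seteqP; split=> [w wV|_ [u uV [v vV <-]]]; last first.
  by rewrite /vertices /= set1E; exact: face_cart.
have [|F [G [faceF faceG wE]]] := face_cart_inv wV.
  by apply/eqP/set0P; exists w.
have : [set w] w by []; rewrite wE => -[u Fu [v Gv wuv]].
exists u; [|exists v => //].
  rewrite /vertices /= (_ : [set u] = F)//; apply/seteqP; split=> [_ ->//|x Fx].
  have : cart_prod F G (row_mx x v) by exact/cart_prodE.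
  by rewrite -wE -wuv => /eq_row_mx[].
rewrite /vertices /= (_ : [set v] = G)//; apply/seteqP; split=> [_ ->//|y Gy].
have : cart_prod F G (row_mx u y) by exact/cart_prodE.
by rewrite -wE -wuv => /eq_row_mx[].
Qed.

Lemma dil_cart A B (s : R) X : dil (cart_prod A B) s X ->
  exists X1 X2, [/\ dil A s X1, dil B s X2 & X = row_mx X1 X2].
Proof.
move=> [s0 [x -> ABx]]; exists (s *: lsubmx x), (s *: rsubmx x); split.
- split=> //; exists (lsubmx x) => // /ABx.
  by rewrite -{1}(hsubmxK x) cart_prodE => -[].
- split=> //; exists (rsubmx x) => // /ABx.
  by rewrite -{1}(hsubmxK x) cart_prodE => -[].
- by rewrite -scale_row_mx hsubmxK.
Qed.

Lemma cart_prodD P Q F G : cart_prod P Q `\` cart_prod F G =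
  cart_prod (P `\` F) Q `|` cart_prod P (Q `\` G).
Proof.
apply/seteqP; split=> [_ [[x Px [y Qy <-]]]|z []].
- rewrite cart_prodE => FG; have [Fx|Fx] := pselect (F x); [right|left];
    apply/cart_prodE; do 2 split=> //.
  by move=> Gy; exact: FG.
- by move=> [x [Px Fx] [y Qy <-]]; split; rewrite cart_prodE// => -[].
- by move=> [x Px [y [Qy Gy] <-]]; split; rewrite cart_prodE// => -[].
Qed.

(** The square of [harmonic p q] is half the harmonic mean of [p ^+ 2] and
    [q ^+ 2], also equal to 0 when both vanish. *)
Definition harmonic (p q : R) := Num.sqrt (p ^+ 2 * q ^+ 2 / (p ^+ 2 + q ^+ 2)).

(** A point of the hull of the vertices outside [F x G] mixes, with some weights
    [s + t = 1], a point of [hull (vertices P `\` F) x Q] and one of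
    [P x hull (vertices Q `\` G)]. By [dilate_dist] its coordinates are at
    distance at least [s p] from [F] and [t q] from [G], and the minimum of
    [(s p)^2 + (t q)^2] over [s + t = 1] is [p^2 q^2 / (p^2 + q^2)]. *)
Lemma cart_width_lbound P Q (p q : R) : polytope P -> polytope Q ->
  0 <= p -> 0 <= q -> width_lbound P p -> width_lbound Q q ->
  width_lbound (cart_prod P Q) (harmonic p q).
Proof.
move=> polP polQ p0 q0 Lp Lq H w w' [faceH H0 _] + Hw'.
have [F [G [faceF faceG HE]]] := face_cart_inv faceH H0.
rewrite HE => -[x Fx [y Gy <-]] {w}.
have [_ PE] := polytope_vertices polP; have [_ QE] := polytope_vertices polQ.
move: Hw'; rewrite vertices_cart HE cart_prodD.
move=> /hull_setU[s [t [X [Y [st]]]]]; rewrite !hull_cart -PE -QE.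
move=> /dil_cart[X1 [X2 [dX1 dX2 ->]]] /dil_cart[Y1 [Y2 [dY1 dY2 ->]]] ->.
have sp : s * p <= enorm (x - (Y1 + X1)).
  apply: (dilate_dist polP p0 Lp faceF (s := 1) (r := t)) => //.
    by rewrite addrC.
  exact/dil1.
have tq : t * q <= enorm (y - (X2 + Y2)).
  by apply: (dilate_dist polQ q0 Lq faceG (s := 1) (r := s)) => //; exact/dil1.
rewrite add_row_mx opp_row_mx add_row_mx (addrC X1) enormE /sqn dotr_row_mx.
apply: ler_wsqrtr; rewrite -!/(sqn _) -!sqr_enorm.
have s0 : 0 <= s by case: dX1.
have t0 : 0 <= t by case: dY1.
apply: (@le_trans _ _ ((s * p) ^+ 2 + (t * q) ^+ 2)); last first.
  by rewrite lerD// ler_sqr// nnegrE ?mulr_ge0// enorm_ge0.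
have [pq0|pqn0] := eqVneq (p ^+ 2 + q ^+ 2) 0.
  by rewrite pq0 invr0 mulr0 addr_ge0// sqr_ge0.
have pq : 0 < p ^+ 2 + q ^+ 2 by rewrite lt_neqAle eq_sym pqn0 addr_ge0 ?sqr_ge0.
rewrite ler_pdivrMr//; have := sqr_ge0 (s * p ^+ 2 - t * q ^+ 2).
(* the product of s^2 p^2 + t^2 q^2 and p^2 + q^2 exceeds p^2 q^2 by this square *)
have -> : s = 1 - t by rewrite -st addrK.
by lra.
Qed.

(** Closest pairs [x, a] for [P] and [y, b] for [Q] combine with the weights that
    minimize [(s p)^2 + (t q)^2]. *)
Lemma cart_width_attained P Q (p q : R) : polytope P -> polytope Q ->
  width_attained P p -> width_attained Q q ->
  width_attained (cart_prod P Q) (harmonic p q).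
Proof.
move=> polP polQ [F [x [a [[faceF F0 FP] Fx Fa pE]]]]
  [G [y [b [[faceG G0 GQ] Gy Gb qE]]]].
have [_ PE] := polytope_vertices polP; have [_ QE] := polytope_vertices polQ.
have Px := face_sub faceF Fx; have Qy := face_sub faceG Gy.
pose t := q ^+ 2 / (p ^+ 2 + q ^+ 2).
have pq0 : 0 <= p ^+ 2 + q ^+ 2 by rewrite addr_ge0 ?sqr_ge0.
exists (cart_prod F G), (row_mx x y).
exists ((1 - t) *: row_mx x b + t *: row_mx a y); split.
- split; first exact: face_cart.
    by apply/eqP/set0P; exists (row_mx x y); exact/cart_prodE.
  move=> FG; apply: FP; apply/seteqP; split; first exact: face_sub.
  move=> z Pz; have : cart_prod P Q (row_mx z y) by exact/cart_prodE.
  by rewrite -FG => /cart_prodE[].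
- exact/cart_prodE.
- rewrite vertices_cart cart_prodD; apply: hull_convex.
  + apply: (@hullS _ _ (cart_prod (vertices P) (vertices Q `\` G))).
      by move=> z; right.
    by rewrite hull_cart -PE; exact/cart_prodE.
  + apply: (@hullS _ _ (cart_prod (vertices P `\` F) (vertices Q))).
      by move=> z; left.
    by rewrite hull_cart -QE; exact/cart_prodE.
  + have [e0|en0] := eqVneq (p ^+ 2 + q ^+ 2) 0.
      by rewrite /t e0 invr0 mulr0 lexx ler01.
    rewrite divr_ge0 ?sqr_ge0//= ler_pdivrMr ?mul1r ?lerDr ?sqr_ge0//.
    by rewrite lt_neqAle eq_sym en0.
- have -> : row_mx x y - ((1 - t) *: row_mx x b + t *: row_mx a y) =
      row_mx (t *: (x - a)) ((1 - t) *: (y - b)).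
    rewrite !scale_row_mx add_row_mx opp_row_mx add_row_mx.
    by congr row_mx; apply/rowP => i; rewrite !mxE; ring.
  rewrite enormE /sqn dotr_row_mx -!/(sqn _) !sqnZ -!sqr_enorm -pE -qE.
  rewrite /harmonic; congr Num.sqrt; rewrite /t.
  have [e0|en0] := eqVneq (p ^+ 2 + q ^+ 2) 0; last by field.
  have /andP[/eqP-> /eqP->] : (p ^+ 2 == 0) && (q ^+ 2 == 0).
    by rewrite -paddr_eq0 ?sqr_ge0// e0.
  by rewrite mul0r !mulr0 addr0 mul0r.
Qed.

Lemma pyramidal_width_cart P Q : polytope P -> polytope Q ->
  proper_faces P !=set0 -> proper_faces Q !=set0 ->
  pyramidal_width (cart_prod P Q) =
  harmonic (pyramidal_width P) (pyramidal_width Q).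
Proof.
move=> polP polQ P0 Q0.
have [LP AP] := pyramidal_width_spec polP P0.
have [LQ AQ] := pyramidal_width_spec polQ Q0.
have P0' : 0 <= pyramidal_width P.
  by case: AP => F [x [a [_ _ _ ->]]]; exact: enorm_ge0.
have Q0' : 0 <= pyramidal_width Q.
  by case: AQ => F [x [a [_ _ _ ->]]]; exact: enorm_ge0.
have AH := cart_width_attained polP polQ AP AQ.
have [|L A] := pyramidal_width_spec (polytope_cart polP polQ).
  by case: AH => F [x [a [pF]]]; exists F.
by apply: width_unique L A _ AH; exact: cart_width_lbound.
Qed.

End Product.

Lemma proper_face_vertex (R : realType) n (P : set 'rV[R]_n) :
  (exists u v, [/\ vertices P u, vertices P v & u <> v]) ->
  proper_faces P !=set0.
Proof.
move=> [u [v [Pu Pv uv]]]; exists [set u]; split=> //.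
  by apply/eqP/set0P; exists u.
move=> uP; apply: uv; have : P v by exact: (face_sub Pv).
by rewrite -uP => ->.
Qed.

Theorem theorem4p5 (R : realType) (n : nat) (P Q : set 'rV[R]_n)
  (polP : polytope P) (polQ : polytope Q)
  (vertP : exists u v : 'rV[R]_n, [/\ vertices P u, vertices P v & u <> v])
  (vertQ : exists u v : 'rV[R]_n, [/\ vertices Q u, vertices Q v & u <> v]) :
  pyramidal_width (cart_prod P Q) =
  Num.sqrt (pyramidal_width P ^+ 2 * pyramidal_width Q ^+ 2 /
            (pyramidal_width P ^+ 2 + pyramidal_width Q ^+ 2)).
Proof. by apply: pyramidal_width_cart => //; exact: proper_face_vertex. Qed.
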